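(* Let $G$ be a transitive reflexive weighted digraph with a metric $d$ on its vertex set $V(G)$. Assume that $(V(G),d)$ is a convex metric space satisfying the Takahashi inequality (as specified in the context) and that all $G$-intervals are convex. Let $C$ be a nonempty $G$-complete and convex subset of $V(G)$ which satisfies Property ( * ). Let $T: C\to C$ be a $G$-monotone Gregus-Ćirić-contraction mapping, i.e. $(T(u),T(v))\in E(G)$ whenever $u,v\in C$ and $(u,v)\in E(G)$, and there exist positive numbers $a,b,c$ with $0<a<1$, $a+b=1$ and $c\le \frac12$ such that $$d(T(u),T(v))\le a\,\max\Big\{d(u,v),\,c\,\big[d(u,T(v))+d(v,T(u))\big]\Big\}+b\,\max\Big\{d(u,T(u)),\,d(v,T(v))\Big\}$$ for any $u,v\in C$ with $(u,v)\in E(G)$. Assume moreover that $c<\frac12$. Let $x\in C$ be such that $(x,T(x))\in E(G)$ (resp. $(T(x),x)\in E(G)$). Then $T$ has a fixed point $\omega\in C$ such that $(x,\omega)\in E(G)$ (resp. $(\omega,x)\in E(G)$). Moreover, if $\Omega\in C$ is another fixed point of $T$ such that $(x,\Omega)\in E(G)$ (resp. $(\Omega,x)\in E(G)$), then $\omega=\Omega$.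
   Context: A digraph $G$ consists of a nonempty vertex set $V(G)$ and an edge set $E(G)\subseteq V(G)\times V(G)$. All digraphs are assumed reflexive: $(x,x)\in E(G)$ for every $x\in V(G)$. $G$ is regarded as a weighted digraph by means of a metric $d$ on $V(G)$, each edge having as weight the distance between its vertices. $G$ is transitive if $(x,z)\in E(G)$ whenever $(x,y)\in E(G)$ and $(y,z)\in E(G)$, for any $x,y,z\in V(G)$. Convex metric space: a metric embedding of $\mathbb{R}$ into a metric space $(M,d)$ is a map $\gamma:\mathbb{R}\to M$ with $d(\gamma(s),\gamma(t))=|s-t|$ for all $s,t\in\mathbb{R}$. The image $\gamma([p,q])$ of a real interval under a metric embedding is called a metric segment; it joins $x$ and $y$ if $\gamma(p)=x$ and $\gamma(q)=y$. $(M,d)$ is a convex metric space if any $x,y\in M$ are joined by a unique metric segment, denoted $[x,y]$. For $\beta\in[0,1]$, $\beta x\oplus(1-\beta)y$ denotes the unique point $z\in[x,y]$ with $d(x,z)=(1-\beta)d(x,y)$ and $d(z,y)=\beta d(x,y)$. Takahashi inequality: $d(\beta x\oplus(1-\beta)y,z)\le\beta d(x,z)+(1-\beta)d(y,z)$ for all $x,y,z\in M$ and $\beta\in[0,1]$. A subset $C\subseteq M$ is convex if $[x,y]\subseteq C$ for any $x,y\in C$. $G$-intervals are the sets $[x,\rightarrow)=\{y\in V(G): (x,y)\in E(G)\}$ and $(\leftarrow,x]=\{y\in V(G): (y,x)\in E(G)\}$, for $x\in V(G)$. A sequence $\{x_n\}$ in $V(G)$ is $G$-increasing if $(x_n,x_{n+1})\in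 E(G)$ for all $n$, $G$-decreasing if $(x_{n+1},x_n)\in E(G)$ for all $n$, and $G$-monotone if it is either $G$-increasing or $G$-decreasing. A subset $C\subseteq V(G)$ is $G$-complete if every $G$-monotone Cauchy sequence in $C$ converges to a point of $C$. A nonempty subset $C\subseteq V(G)$ has Property ( * ) if for any $G$-increasing (resp. $G$-decreasing) sequence $\{x_n\}$ in $C$ which converges to $x$, there is a subsequence $\{x_{k_n}\}$ with $(x_{k_n},x)\in E(G)$ (resp. $(x,x_{k_n})\in E(G)$) for all $n\in\mathbb{N}$. A fixed point of $T$ is a point $x\in C$ with $T(x)=x$. *)

(* Defs.v *)
From mathcomp Require Export all_boot all_order all_algebra.
From mathcomp Require Export all_classical all_reals topology sequences.

Set Implicit Arguments.
Unset Strict Implicit.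
Unset Printing Implicit Defensive.

Import Order.TTheory GRing.Theory Num.Theory.

Local Open Scope classical_set_scope.
Local Open Scope ring_scope.

Section ConvexMetricSpaces.
Context {R : realType} {M : metricType R}.
Implicit Types (x y z : M) (S C : set M) (beta : R).

Definition metric_embedding (gamma : R -> M) : Prop :=
  forall s t : R, mdist (gamma s) (gamma t) = `|s - t|.

Definition metric_segment_joining x y S : Prop :=
  exists (gamma : R -> M) (p q : R),
    [/\ metric_embedding gamma, p <= q, S = gamma @` `[p, q],
        gamma p = x & gamma q = y].

(* [x, y]; only meaningful when a unique metric segment joins x and y, and
   set0 if there is none. *)
Definition msegment x y : set M := xget set0 (metric_segment_joining x y).

(* beta x (+) (1 - beta) y; the default value x is irrelevant in a convex
   metric space, where the point described exists and is unique. *)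
Definition mcomb beta x y : M :=
  xget x [set z | [/\ msegment x y z,
                      mdist x z = (1 - beta) * mdist x y
                    & mdist z y = beta * mdist x y]].

Definition mconvex C : Prop :=
  forall x y, C x -> C y -> msegment x y `<=` C.

End ConvexMetricSpaces.

Definition convex_metric_space {R : realType} (M : metricType R) : Prop :=
  forall x y : M, exists! S : set M, metric_segment_joining x y S.

Definition takahashi_inequality {R : realType} (M : metricType R) : Prop :=
  forall (x y z : M) (beta : R), 0 <= beta <= 1 ->
    mdist (mcomb beta x y) z <= beta * mdist x z + (1 - beta) * mdist y z.

(* A digraph is given by its edge set E; its vertex set is the whole type V,
   and the weight of an edge (x, y) is mdist x y. *)
Section Digraphs.
Context {R : realType} {V : metricType R}.
Variable E : set (V * V).
Implicit Types (x y z : V) (u : nat -> V) (C : set V).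

Definition digraph_reflexive : Prop := forall x, E (x, x).

Definition digraph_transitive : Prop :=
  forall x y z, E (x, y) -> E (y, z) -> E (x, z).

Definition G_upper x : set V := [set y | E (x, y)].

Definition G_lower x : set V := [set y | E (y, x)].

Definition G_intervals_convex : Prop :=
  forall x, mconvex (G_upper x) /\ mconvex (G_lower x).

Definition G_increasing u : Prop := forall n, E (u n, u n.+1).

Definition G_decreasing u : Prop := forall n, E (u n.+1, u n).

Definition G_monotone u : Prop := G_increasing u \/ G_decreasing u.

Definition G_complete C : Prop :=
  forall u, (forall n, C (u n)) -> G_monotone u -> cauchy (u @ \oo) ->
    exists2 x, C x & u @ \oo --> x.

Definition property_star C : Prop :=
  C !=set0 /\
  forall u x, (forall n, C (u n)) -> u @ \oo --> x ->
    (G_increasing u ->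
       exists2 k : nat -> nat, increasing_seq k & forall n, E (u (k n), x)) /\
    (G_decreasing u ->
       exists2 k : nat -> nat, increasing_seq k & forall n, E (x, u (k n))).

Definition G_monotone_map C (T : V -> V) : Prop :=
  forall u v : V, C u -> C v -> E (u, v) -> E (T u, T v).

Definition gregus_ciric_ineq C (T : V -> V) (a b c : R) : Prop :=
  forall u v : V, C u -> C v -> E (u, v) ->
    mdist (T u) (T v) <=
      a * Num.max (mdist u v) (c * (mdist u (T v) + mdist v (T u)))
      + b * Num.max (mdist u (T u)) (mdist v (T v)).

Definition gregus_ciric_contraction C (T : V -> V) (a b c : R) : Prop :=
  [/\ G_monotone_map C T,
      [/\ 0 < a < 1, 0 < b, a + b = 1 & 0 < c <= 2^-1]
    & gregus_ciric_ineq C T a b c].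

Definition fixed_point C (T : V -> V) x : Prop := C x /\ T x = x.

End Digraphs.

(* Main.v *)
Require Import Defs.
From mathcomp Require Import all_boot all_order all_algebra.
From mathcomp Require Import all_classical all_reals.
From mathcomp Require Import topology normedtype sequences.
From mathcomp Require Import ring lra zify.

(** Write [u <= v] for an edge [(u, v)], [d] for the distance, and let
    [x <= T x], [r = d x (T x)].  The orbit [y_k = T^k x] increases, so any two
    of its points are comparable.  The inequality for [y_k <= y_(k+1)] only says
    that [d y_k y_(k+1)] does not increase: the coefficients [a + b = 1] leave no
    room for a geometric decay.  Following Gregus, the displacement [d u (T u)]
    is decreased by averaging instead: for [N] large, the midpoint [z] of [y_N]
    and [y_(N+1)] satisfies [d z (T z) <= (1 - a / 16) r]
    ([displacement_midpoint_le]).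

    The reason is that the contraction inequality damps everything in excess of
    [r].  The triangle inequality gives [d y_i y_(i+m) <= m r]; feeding this
    bound into the inequality, where [c <= 1 / 2], multiplies the excess over
    [r] by [a], and repeating gives
    [d y_i y_(i+m) <= (1 + a^n (m - 1)) r] once [n <= i]
    ([orbit_dist_le]).  The same argument bounds [d y_k (T z)]
    ([orbit_image_midpoint_le]).  Assume that [d z (T z) <= r].  Up to an error
    of order [a^N r], [y_N] is then within [r] of [T z], while [z] is within
    [r / 2] of both [y_N] and [y_(N+1)].  One more use of the inequality, for
    [y_N <= z], brings [d y_(N+1) (T z)] down to about [(1 - a / 4) r], and the
    bound on [d z (T z)] follows by averaging the distances from [T z] to [y_N]
    and [y_(N+1)].

    As [G]-intervals are convex, [x <= y_N <= z <= y_(N+1) <= T z], so the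
    construction can be iterated.  It yields an increasing sequence [z_n] whose
    displacements decay geometrically.  Between comparable points, distances are
    controlled by displacements ([dist_le_displacements]); therefore [z_n] is
    Cauchy, and converges to some [omega] above all [z_n].  The displacement of
    [omega] is controlled by that of [z_n] and by [d z_n omega]
    ([displacement_le]), so [omega] is fixed.  If [Omega] is another fixed point
    above [x], convexity of intervals keeps all [z_n] below [Omega], hence
    [d z_n Omega] tends to [0] too and [Omega = omega].  The decreasing case is
    the increasing case for the digraph with all edges reversed. *)

Set Implicit Arguments.
Unset Strict Implicit.
Unset Printing Implicit Defensive.

Import Order.TTheory GRing.Theory Num.Theory.
Import numFieldNormedType.Exports.

Local Open Scope classical_set_scope.
Local Open Scope ring_scope.

(** * Geometric sequences and midpoints *)

Lemma near_geometric_lt (R : realType) (q r e : R) :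
  0 <= q < 1 -> 0 < e -> \forall n \near \oo, q ^+ n * r < e.
Proof.
move=> /andP[q0 q1] e0.
have cvg0 : q ^+ n * r @[n --> \oo] --> (0 : R).
  rewrite -(mul0r r); apply: cvgM; last exact: cvg_cst.
  by apply: cvg_expr; rewrite ger0_norm.
near=> n; apply: le_lt_trans (ler_norm _) _.
by near: n; apply: cvgr0_norm_lt.
Unshelve. all: by end_near. Qed.

(** When no point has the properties that define [mcomb beta x y], its value is
    [x], which lies in [C] too. *)
Lemma mcomb_mem (R : realType) (M : metricType R) (C : set M) (beta : R)
    (x y : M) :
  mconvex C -> C x -> C y -> C (mcomb beta x y).
Proof.
move=> Cconvex Cx Cy; rewrite /mcomb.
by case: xgetP => [z _ [xyz _ _]|//]; apply: (Cconvex x y).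
Qed.

Lemma mdist_midpoint_le (R : realType) (M : metricType R) (x y w : M) :
  takahashi_inequality M ->
  mdist w (mcomb 2^-1 x y) <= (mdist w x + mdist w y) / 2.
Proof.
move=> tak; rewrite !(metric_sym w).
have : mdist (mcomb 2^-1 x y) w
    <= 2^-1 * mdist x w + (1 - 2^-1) * mdist y w by apply: tak; lra.
lra.
Qed.

(** * Consequences of the contraction inequality *)

Section Contraction.
Context {R : realType} {V : metricType R} {E : set (V * V)} {C : set V}.
Context {T : V -> V} {a b c : R}.
Hypothesis Erefl : digraph_reflexive E.
Hypothesis Etrans : digraph_transitive E.
Hypothesis TC : set_fun C C T.
Hypothesis Tcontraction : gregus_ciric_contraction E C T a b c.
Implicit Types (u v w : V).

Let a_gt0 : 0 < a.
Proof. by case: Tcontraction => _ [/andP[]]. Qed.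

Let a_lt1 : a < 1.
Proof. by case: Tcontraction => _ [/andP[]]. Qed.

Let bE : b = 1 - a.
Proof. by case: Tcontraction => _ [_ _ ? _] _; lra. Qed.

Let Tmono u v : C u -> C v -> E (u, v) -> E (T u, T v).
Proof. by case: Tcontraction => + _ _; apply. Qed.

(** The form in which the contraction inequality is used below: the maxima are
    replaced by upper bounds [P] and [M] of their entries, and [c] by
    [1 / 2]. *)
Lemma gregus_ciric_le u v P M : C u -> C v -> E (u, v) ->
  mdist u v <= P -> mdist u (T v) + mdist v (T u) <= 2 * P ->
  mdist u (T u) <= M -> mdist v (T v) <= M ->
  mdist (T u) (T v) <= a * P + b * M.
Proof.
move=> Cu Cv Euv uvP crossP uM vM; have a0 := a_gt0.
have [_ [_ b0 _ /andP[c0 c12]] ineq] := Tcontraction.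
have cross0 : 0 <= mdist u (T v) + mdist v (T u).
  by rewrite addr_ge0 ?mdist_ge0.
apply: le_trans (ineq u v Cu Cv Euv) _.
apply: lerD; apply: ler_wpM2l; rewrite ?ge_max; try lra.
by rewrite uvP /=; nra.
Qed.

Lemma displacement_image_le u : C u -> E (u, T u) ->
  mdist (T u) (T (T u)) <= mdist u (T u).
Proof.
move=> Cu Eu; have a0 := a_gt0; have a1 := a_lt1.
have CTu := TC Cu; rewrite leNgt; apply/negP => lt_uTu.
have := @gregus_ciric_le u (T u)
  ((mdist u (T u) + mdist (T u) (T (T u))) / 2) (mdist (T u) (T (T u)))
  Cu CTu Eu.
have := metric_triangle u (T u) (T (T u)); rewrite mdistxx bE; nra.
Qed.

(** Replacing [T u] and [T v] by [u] and [v] costs only displacements, so the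
    inequality bounds [d u v] by [a * d u v] and displacements; [b = 1 - a]
    remains on the left. *)
Lemma dist_le_displacements u v : C u -> C v -> E (u, v) ->
  b * mdist u v <= 3 * (mdist u (T u) + mdist v (T v)).
Proof.
move=> Cu Cv Euv; have a0 := a_gt0; have a1 := a_lt1.
have u0 := mdist_ge0 u (T u); have v0 := mdist_ge0 v (T v).
have := @gregus_ciric_le u v
  (mdist u v + (mdist u (T u) + mdist v (T v)) / 2)
  (mdist u (T u) + mdist v (T v)) Cu Cv Euv.
have := metric_triangle u v (T v); have := metric_triangle v u (T u).
have := metric_triangle u (T u) v; have := metric_triangle (T u) (T v) v.
rewrite (metric_sym v u) (metric_sym (T v) v) bE; nra.
Qed.

(** The displacement of [v] comes back on the right with the coefficient
    [a / 2] from the cross distances and [b] from the displacement term, and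
    [1 - (a / 2 + b) = a / 2] is positive. *)
Lemma displacement_le u v : C u -> C v -> E (u, v) ->
  a * mdist v (T v) <= 6 * (mdist u v + mdist u (T u)).
Proof.
move=> Cu Cv Euv; have a0 := a_gt0; have a1 := a_lt1.
have u0 := mdist_ge0 u (T u); have v0 := mdist_ge0 v (T v).
have uv0 := mdist_ge0 u v.
have := @gregus_ciric_le u v
  (mdist u v + (mdist u (T u) + mdist v (T v)) / 2)
  (mdist u (T u) + mdist v (T v)) Cu Cv Euv.
have := metric_triangle u v (T v); have := metric_triangle v u (T u).
have := metric_triangle v u (T v); have := metric_triangle u (T u) (T v).
rewrite (metric_sym v u) bE; nra.
Qed.

(** * The orbit of a point below its image *)

Section Orbit.
Context {x : V}.
Hypothesis Cx : C x.
Hypothesis xTx : E (x, T x).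
Local Notation y k := (iter k T x).
Local Notation r := (mdist x (T x)).

Lemma orbit_mem k : C (y k).
Proof. by elim: k => //= k; apply: TC. Qed.

Lemma orbit_edge k : E (y k, y k.+1).
Proof.
elim: k => //= k IH; apply: Tmono => //; first exact: orbit_mem.
exact: (orbit_mem k.+1).
Qed.

Lemma orbit_increasing i j : (i <= j)%N -> E (y i, y j).
Proof.
move=> /subnKC <-; elim: (j - i)%N => [|m IH]; first by rewrite addn0.
by rewrite addnS; apply: Etrans IH (orbit_edge _).
Qed.

Lemma orbit_step_le k : mdist (y k) (y k.+1) <= r.
Proof.
elim: k => //= k; apply: le_trans.
exact: displacement_image_le (orbit_mem k) (orbit_edge k).
Qed.

(** Going from [n] to [n + 1], the cross distances pair an [m + 1] with an
    [m - 1], so that their average has the same bound as the direct distance;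
    for [m = 0] there is no excess to damp, by [orbit_step_le]. *)
Lemma orbit_dist_le n i m :
  mdist (y (n + i)) (y (n + i + m.+1)) <= (1 + a ^+ n * m%:R) * r.
Proof.
elim: n i m => [|n IH] i m.
  rewrite add0n expr0 mul1r; elim: m => [|m IHm].
    by rewrite addr0 mul1r addn1; apply: orbit_step_le.
  have := metric_triangle (y i) (y (i + m.+1)) (y (i + m.+2)).
  have := orbit_step_le (i + m.+1); rewrite (addnS i m.+1) -natr1; lra.
case: m => [|m]; first by rewrite mulr0 addr0 mul1r addn1; apply: orbit_step_le.
rewrite !addSn.
have IHdirect := IH i m.+1; have IHlong := IH i m.+2.
have IHshort := IH i.+1 m.
have -> : (1 + a ^+ n.+1 * m.+1%:R) * r
    = a * ((1 + a ^+ n * m.+1%:R) * r) + b * r by rewrite bE exprS; ring.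
apply: gregus_ciric_le => //; try exact: orbit_mem.
- by apply: orbit_increasing; lia.
- move: IHlong IHshort; rewrite (metric_sym (y (n + i + m.+2))).
  rewrite !(addSn, addnS) -!natr1; lra.
- exact: orbit_step_le.
- exact: orbit_step_le.
Qed.

(** * The midpoint of two consecutive points of the orbit *)

Section Midpoint.
Hypothesis Vtakahashi : takahashi_inequality V.
Hypothesis intervals_convex : G_intervals_convex E.
Hypothesis Cconvex : mconvex C.
Context {N : nat}.
Local Notation z := (mcomb 2^-1 (y N) (y N.+1)).

Lemma midpoint_mem : C z.
Proof.
by apply: mcomb_mem => //; [exact: orbit_mem|exact: (orbit_mem N.+1)].
Qed.

Lemma midpoint_ge w : E (w, y N) -> E (w, z).
Proof.
move=> wN; have [up _] := intervals_convex w.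
by apply: (mcomb_mem _ up) => //; apply: Etrans wN (orbit_edge N).
Qed.

Lemma midpoint_le w : E (y N.+1, w) -> E (z, w).
Proof.
move=> Nw; have [_ low] := intervals_convex w.
by apply: (mcomb_mem _ low) => //; apply: Etrans (orbit_edge N) Nw.
Qed.

Lemma midpoint_edge : E (z, T z).
Proof.
apply: midpoint_le; apply: (Tmono (orbit_mem N) midpoint_mem).
exact: midpoint_ge.
Qed.

Lemma orbit_le_midpoint k : (k <= N)%N -> E (y k, z).
Proof. by move=> kN; apply: midpoint_ge; apply: orbit_increasing. Qed.

Lemma orbit_midpoint_half_le :
  mdist (y N) z <= r / 2 /\ mdist (y N.+1) z <= r / 2.
Proof.
have stepN := orbit_step_le N.
have := mdist_midpoint_le (y N) (y N.+1) (y N) Vtakahashi.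
have := mdist_midpoint_le (y N) (y N.+1) (y N.+1) Vtakahashi.
by rewrite !mdistxx (metric_sym (y N.+1) (y N)); split; lra.
Qed.

Lemma orbit_midpoint_le k m : (k + m = N)%N ->
  mdist (y k) z <= (1 + a ^+ k * m%:R) * r.
Proof.
have r0 : 0 <= r := mdist_ge0 _ _.
have a0 := a_gt0; have a1 := a_lt1.
have ak0 : 0 <= a ^+ k by apply: exprn_ge0; lra.
case: m => [|m] kmN.
  have [+ _] := orbit_midpoint_half_le.
  have -> : N = k by rewrite -kmN addn0.
  by rewrite mulr0; lra.
apply: le_trans (mdist_midpoint_le _ _ _ Vtakahashi) _.
have := orbit_dist_le k 0 m; have := orbit_dist_le k 0 m.+1.
rewrite !addn0 (addnS k m.+1) kmN -natr1; nra.
Qed.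

(** The displacement of [z] is not yet known to be at most [r], whence the
    common bound [M].  The bound holds for [k = 0] by the triangle inequality,
    and each step along the orbit multiplies the excess by [a], as for
    [orbit_dist_le]. *)
Lemma orbit_image_midpoint_le M k m : r <= M -> mdist z (T z) <= M ->
  (k + m = N)%N -> mdist (y k) (T z) <= (1 + a ^+ k * m.+1%:R) * M.
Proof.
move=> rM zM; have r0 : 0 <= r := mdist_ge0 _ _.
have a0 := a_gt0; have a1 := a_lt1.
elim: k m => [|k IH] m kmN.
  have := metric_triangle (y 0) z (T z).
  have := orbit_midpoint_le kmN; rewrite !expr0 !mul1r -natr1.
  have : 0 <= m%:R :> R by []. nra.
have kmN' : (k + m.+1 = N)%N by lia.
have ak0 : 0 <= a ^+ k by apply: exprn_ge0; lra.
have m0 : 0 <= m%:R :> R by [].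
have akm0 : 0 <= a ^+ k * m%:R by apply: mulr_ge0.
have aakm : a * (a ^+ k * m%:R) <= a ^+ k * m%:R by nra.
have -> : (1 + a ^+ k.+1 * m.+1%:R) * M
    = a * ((1 + a ^+ k * m.+1%:R) * M) + b * M by rewrite bE exprS; ring.
apply: gregus_ciric_le => //.
- exact: orbit_mem.
- exact: midpoint_mem.
- by apply: orbit_le_midpoint; lia.
- have := orbit_midpoint_le kmN'; rewrite -natr1; nra.
- have := IH _ kmN'; have := orbit_midpoint_le kmN.
  rewrite (metric_sym z) exprS -!natr1 -mulrA; nra.
- exact: le_trans (orbit_step_le k) rM.
Qed.

(** In the mean of [d y_N (T z)] and [d y_(N+1) (T z)], the errors add up to at
    most [3 / 4 * a^N], against a gain of [a / 8]; the condition on [N] keeps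
    half of the gain. *)
Lemma displacement_midpoint_le : a ^+ N <= a / 12 ->
  mdist z (T z) <= (1 - a / 16) * r.
Proof.
move=> aN; have r0 : 0 <= r := mdist_ge0 _ _.
have a0 := a_gt0; have a1 := a_lt1.
have aN0 : 0 <= a ^+ N by apply: exprn_ge0; lra.
set D := mdist z (T z); set M := Num.max r D.
have rM : r <= M by rewrite le_max lexx.
have DM : D <= M by rewrite le_max lexx orbT.
have M0 : 0 <= M by apply: le_trans rM.
have [halfN halfN1] := orbit_midpoint_half_le.
have imN : mdist (y N) (T z) <= (1 + a ^+ N) * M.
  by have := orbit_image_midpoint_le rM DM (addn0 N); rewrite mulr1.
have imN1 : mdist (y N.+1) (T z) <= a * ((3 / 4 + a ^+ N / 2) * M) + b * M.
  apply: gregus_ciric_le => //.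
  - exact: orbit_mem.
  - exact: midpoint_mem.
  - exact: orbit_le_midpoint.
  - nra.
  - by rewrite (metric_sym z); move: halfN1 => /=; nra.
  - exact: le_trans (orbit_step_le N) rM.
have DleM : D <= (1 - a / 16) * M.
  have := mdist_midpoint_le (y N) (y N.+1) (T z) Vtakahashi.
  rewrite !(metric_sym (T z)) -/D; move: imN1; rewrite bE => imN1 Dle.
  apply: (le_trans Dle).
  have aaN : a * a ^+ N <= a ^+ N by nra.
  nra.
(* If [r < D], then [M = D] and the bound just proved is absurd. *)
have [rD|Dr] := ltP r D; last by rewrite -[r](max_l Dr).
have aD : 0 < a * D by apply: mulr_gt0 => //; apply: le_lt_trans rD.
by move: DleM; rewrite /M (max_r (ltW rD)); lra.
Qed.

End Midpoint.
End Orbit.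

(** * The iterated midpoints and their limit *)

Lemma exists_fixed_point_above x :
  takahashi_inequality V -> G_intervals_convex E -> mconvex C ->
  G_complete E C -> property_star E C -> C x -> E (x, T x) ->
  exists omega, [/\ fixed_point C T omega, E (x, omega)
    & forall Omega, fixed_point C T Omega -> E (x, Omega) -> omega = Omega].
Proof.
move=> tak int_convex Cconvex Ccomplete [_ star] Cx xTx.
have a0 := a_gt0; have a1 := a_lt1.
have b0 : 0 < b by rewrite bE; lra.
have [N aN] : exists N, a ^+ N <= a / 12.
  have [|//|N _ /(_ N (leqnn N)) /ltW aN] := @near_geometric_lt _ a 1 (a / 12).
  - by rewrite ltW.
  - by lra.
  - by exists N; rewrite mulr1 in aN.
pose z n := iter n (fun u => mcomb 2^-1 (iter N T u) (iter N.+1 T u)) x.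
have zC n : C (z n) /\ E (z n, T (z n)).
  elim: n => [//|n [Cz zTz]]; split; first exact: midpoint_mem.
  exact: midpoint_edge.
have zS n : E (z n, z n.+1).
  have [Cz zTz] := zC n; apply: midpoint_ge => //.
  exact: (orbit_increasing Cz zTz (leq0n N)).
have zincr m n : (m <= n)%N -> E (z m, z n).
  move=> /subnKC <-; elim: (n - m)%N => [|k IH]; first by rewrite addn0.
  by rewrite addnS; apply: Etrans IH (zS _).
have displacement_geometric n :
    mdist (z n) (T (z n)) <= (1 - a / 16) ^+ n * mdist x (T x).
  elim: n => [|n IH]; first by rewrite mul1r.
  have [Cz zTz] := zC n; rewrite exprS -mulrA.
  apply: le_trans (displacement_midpoint_le Cz zTz tak int_convex Cconvex aN) _.
  by apply: ler_wpM2l IH; lra.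
have displacement_cvg0 e : 0 < e ->
    \forall n \near \oo, mdist (z n) (T (z n)) < e.
  move=> e0; have : 0 <= 1 - a / 16 < 1 by apply/andP; split; lra.
  move=> /(near_geometric_lt (mdist x (T x))) /(_ e0).
  by apply: filterS => n; apply: le_lt_trans.
have z_cauchy : cauchy (z @ \oo).
  apply: cauchy_exP => e e0.
  have [|n0 _ small] := displacement_cvg0 (b * e / 6).
    by rewrite divr_gt0 // mulr_gt0.
  exists (z n0), n0 => // n n0n; rewrite /= ballEmdist /=.
  rewrite -(ltr_pM2l b0).
  have := dist_le_displacements (zC n0).1 (zC n).1 (zincr _ _ n0n).
  move/le_lt_trans; apply.
  by have := small n0 (leqnn n0); have := small n n0n; rewrite /=; lra.
have [omega Comega z_omega] :=
  Ccomplete z (fun n => (zC n).1) (or_introl zS) z_cauchy.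
have z_dist_omega e : 0 < e -> \forall n \near \oo, mdist (z n) omega < e.
  move=> e0; near=> n; rewrite metric_sym; near: n.
  exact (metricType_numDomainType.cvgr_dist_lt z_omega e0).
have zle_omega n : E (z n, omega).
  (* Only a subsequence [z (k n)] is known to lie below [omega]; as [n <= k n],
     it dominates the whole sequence. *)
  have [k kincr zk_omega] := (star z omega (fun n => (zC n).1) z_omega).1 zS.
  have le_k m : (m <= k m)%N.
    elim: m => // m IH; apply: leq_ltn_trans IH _.
    by have := leW_mono kincr m m.+1; rewrite !ltEnat /= ltnSn.
  exact: Etrans (zincr _ _ (le_k n)) (zk_omega n).
exists omega; split; last 2 first.
- exact: (zle_omega 0).
- move=> Omega [COmega fixOmega] xOmega.
  have zle_Omega n : E (z n, Omega).
    elim: n => // n zOmega; have [Cz zTz] := zC n.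
    have orbit_le_Omega k : E (iter k T (z n), Omega).
      elim: k => //= k IH; rewrite -fixOmega.
      by apply: Tmono => //; apply: orbit_mem.
    exact: midpoint_le (orbit_le_Omega N.+1).
  suff z_Omega : z @ \oo --> Omega.
    exact (cvg_unique (@metric_hausdorff R V) z_omega z_Omega).
  apply/metricType_numDomainType.cvgrPdist_lt => e e0.
  have := displacement_cvg0 (b * e / 3).
  rewrite divr_gt0 ?mulr_gt0 // => /(_ isT).
  apply: filterS => n zn; rewrite metric_sym -(ltr_pM2l b0).
  apply: le_lt_trans (dist_le_displacements (zC n).1 COmega (zle_Omega n)) _.
  by rewrite fixOmega mdistxx; lra.
split=> //; apply: esym; apply: mdist_positivity.
apply/eqP; rewrite eq_le mdist_ge0 andbT; apply/ler_addgt0Pl => e e0.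
rewrite addr0 -(ler_pM2l a0).
have e12 : 0 < a * e / 12 by rewrite divr_gt0 // mulr_gt0.
have [n [dn zn]] : exists n, mdist (z n) (T (z n)) < a * e / 12 /\
    mdist (z n) omega < a * e / 12.
  by apply: (@filter_ex _ \oo); apply: filterI;
    [apply: displacement_cvg0|apply: z_dist_omega].
apply: le_trans (displacement_le (zC n).1 Comega (zle_omega n)) _; lra.
Unshelve. all: by end_near. Qed.

End Contraction.

(** * Reversing the edges *)

Definition converse {V : Type} (E : set (V * V)) : set (V * V) :=
  [set e | E (e.2, e.1)].

Lemma gregus_ciric_contraction_converse (R : realType) (V : metricType R)
    (E : set (V * V)) (C : set V) (T : V -> V) (a b c : R) :
  gregus_ciric_contraction E C T a b c ->
  gregus_ciric_contraction (converse E) C T a b c.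
Proof.
move=> [mono coeffs ineq]; split=> // u v Cu Cv /= Evu; first exact: mono.
rewrite metric_sym (metric_sym u v) maxC.
rewrite [X in c * X]addrC [X in _ + b * X]maxC [X in a * X]maxC.
exact: ineq.
Qed.

Lemma G_complete_converse (R : realType) (V : metricType R)
    (E : set (V * V)) (C : set V) :
  G_complete E C -> G_complete (converse E) C.
Proof. by move=> Ccomplete u Cu [] ?; apply: Ccomplete => //; [right|left]. Qed.

Lemma property_star_converse (R : realType) (V : metricType R)
    (E : set (V * V)) (C : set V) :
  property_star E C -> property_star (converse E) C.
Proof. by move=> [C0 star]; split=> // u x Cu /(star u x Cu)[]. Qed.

Theorem theorem4p1 (R : realType) (V : metricType R) (E : set (V * V))
    (Erefl : digraph_reflexive E) (Etrans : digraph_transitive E)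
    (Vconvex : convex_metric_space V) (Vtakahashi : takahashi_inequality V)
    (intervals_convex : G_intervals_convex E)
    (C : set V) (Cnonempty : C !=set0) (Ccomplete : G_complete E C)
    (Cconvex : mconvex C) (Cstar : property_star E C)
    (T : V -> V) (TC : set_fun C C T)
    (a b c : R) (Tcontraction : gregus_ciric_contraction E C T a b c)
    (c_lt_half : c < 2^-1) (x : V) (Cx : C x) :
  (E (x, T x) ->
     exists omega : V,
       [/\ fixed_point C T omega, E (x, omega)
         & forall Omega : V,
             fixed_point C T Omega -> E (x, Omega) -> omega = Omega]) /\
  (E (T x, x) ->
     exists omega : V,
       [/\ fixed_point C T omega, E (omega, x)
         & forall Omega : V,
             fixed_point C T Omega -> E (Omega, x) -> omega = Omega]).
Proof.
split=> Ex; first exact: (exists_fixed_point_above Erefl Etrans TC Tcontraction).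
apply: (@exists_fixed_point_above _ _ (converse E) C T a b c) => //.
- by move=> u v w Evu Ewv; apply: Etrans Ewv Evu.
- exact: gregus_ciric_contraction_converse.
- by move=> u; have [up low] := intervals_convex u.
- exact: G_complete_converse.
- exact: property_star_converse.
Qed.
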